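(* Let $D\in\mathcal E^n$ have embedding dimension $r$. Let $C_k$, for $k\in\mathcal C$, be a given clique with node $l\notin C_k$, and let $\beta:=\{j_1,\dots,j_r\}\subseteq C_k$ be such that the distances $D_{lj_i}$, for $i=1,\dots,r$, are known. If $$\operatorname{rank}\mathcal K^\dagger(D[\beta])=r-1,$$ then we can determine two possible completions of the distances. If exactly one of these two completions is feasible, then $l$ can be absorbed by the clique $C_k$. We can also complete the missing elements in column (row) $l$ of $D[C_k\cup\{l\}]$.
   Context: A real symmetric $n\times n$ matrix $D$ is a Euclidean distance matrix (EDM) if there are points $p_1,\dots,p_n\in\mathbb R^r$, for some $r$, with $D_{ij}=\|p_i-p_j\|_2^2$ for all $i,j$ (squared distances); the smallest such $r$ is the embedding dimension of $D$. $\mathcal E^n$ is the set of $n\times n$ EDMs. The embedding dimension $r$ is given and fixed. Only some entries of $D$ are known, and the EDM completion problem consists of finding the missing entries. Nodes are the indices $1,\dots,n$. For an index set $\alpha$, $D[\alpha]$ is the principal submatrix of $D$ with rows and columns indexed by $\alpha$. A clique is a set of indices $\alpha\subseteq\{1,\dots,n\}$ such that all entries of $D[\alpha]$ are known. $\{C_i\}_{i\in\mathcal C}$ is a family of cliques indexed by a finite set $\mathcal C$ of positive integers. That a node $l$ is absorbed by a clique $C_k$ means that the clique $C_k$ is grown to the clique $C_k\cup\{l\}$. The completions referred to are completions, with embedding dimension $r$, of the missing distances in $D[C_k\cup\{l\}]$. A completion is feasible if it satisfies the related distance equality constraints (given by known entries of $D$) and, if included, the related lower bound inequality constraints obtained from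 the radio range $R>0$ (distances between nodes within radio range are known, so a pair whose distance is not known is not within radio range). The operator $\mathcal K^\dagger$ on real symmetric $m\times m$ matrices is $\mathcal K^\dagger(D)=-\frac12J\,\mathrm{offDiag}(D)\,J$, where $J=I-\frac1m ee^T$, $e\in\mathbb R^m$ is the all-ones vector, and $\mathrm{offDiag}(D)$ is $D$ with its diagonal replaced by zeros. It is the generalized inverse of the linear operator $\mathcal K(Y)=\operatorname{diag}(Y)e^T+e\operatorname{diag}(Y)^T-2Y$, where $\operatorname{diag}(Y)$ is the vector of diagonal entries of $Y$. *)

(* Defs.v *)
From mathcomp Require Import all_boot all_order all_algebra.
From mathcomp Require Import reals.
Set Implicit Arguments. Unset Strict Implicit. Unset Printing Implicit Defensive.
Import Order.TTheory GRing.Theory Num.Theory.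
Local Open Scope ring_scope.

(* The principal submatrix A[alpha]: its i-th row and column are those of A
   with index [enum_val i], the i-th element of alpha. *)
Definition principal (T : Type) (n : nat) (A : 'M[T]_n) (alpha : {set 'I_n}) :
  'M[T]_#|alpha| :=
  mxsub (fun i => enum_val i) (fun i => enum_val i) A.

(* The squared Euclidean norm of u - v; it is written out because the library
   norm on matrices is the maximum norm. *)
Definition sqdist (R : realType) (r : nat) (u v : 'rV[R]_r) : R :=
  \sum_(k < r) (u 0 k - v 0 k) ^+ 2.

Definition embeds (R : realType) (r n : nat) (D : 'M[R]_n) : Prop :=
  exists p : 'I_n -> 'rV[R]_r, forall i j, D i j = sqdist (p i) (p j).

Definition EDM (R : realType) (n : nat) (D : 'M[R]_n) : Prop :=
  exists r, embeds r D.

Definition embedding_dim (R : realType) (n : nat) (D : 'M[R]_n) (r : nat) :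
  Prop :=
  embeds r D /\ forall s, embeds s D -> (r <= s)%N.

Definition offDiag (R : realType) (m : nat) (D : 'M[R]_m) : 'M[R]_m :=
  \matrix_(i, j) if i == j then 0 else D i j.

Definition centering (R : realType) (m : nat) : 'M[R]_m :=
  1%:M - m%:R^-1 *: const_mx 1.

Definition Kdagger (R : realType) (m : nat) (D : 'M[R]_m) : 'M[R]_m :=
  - 2^-1 *: (centering R m *m offDiag D *m centering R m).

(* A partially known matrix is a matrix P over [option R]; [P i j = None] means
   that the (i, j) entry is not known. *)
Definition completes (R : realType) (n : nat) (P : 'M[option R]_n)
    (E : 'M[R]_n) : Prop :=
  forall i j v, P i j = Some v -> E i j = v.

Definition clique (R : realType) (n : nat) (P : 'M[option R]_n)
    (alpha : {set 'I_n}) : Prop :=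
  forall i j, i \in alpha -> j \in alpha -> isSome (P i j).

(* [range] is [Some rho] if the lower bound constraints coming from the radio
   range rho are included, and [None] if they are not. Matrix entries are
   squared distances, whence rho ^+ 2. *)
Definition lower_bounds (R : realType) (n : nat) (range : option R)
    (P : 'M[option R]_n) (E : 'M[R]_n) : Prop :=
  forall rho, range = Some rho ->
  forall i j, i != j -> P i j = None -> rho ^+ 2 <= E i j.

Definition feasible (R : realType) (n : nat) (range : option R)
    (P : 'M[option R]_n) (E : 'M[R]_n) : Prop :=
  completes P E /\ lower_bounds range P E.

(* The part of P that produces the candidate completions: the entries of the
   clique C and the distances between l and beta. Any other known distance from
   l to C is not used here; it is a constraint tested by [feasible]. *)
Definition absorption_data (R : realType) (n : nat) (P : 'M[option R]_n)
    (C : {set 'I_n}) (l : 'I_n) (beta : {set 'I_n}) : 'M[option R]_n :=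
  \matrix_(i, j)
    if [|| (i \in C) && (j \in C), (i == l) && (j \in beta)
         | (i \in beta) && (j == l)]
    then P i j else None.

(* Candidate completions of D[C :|: {l}]. [embeds r E] says that the embedding
   dimension of E is at most r: if C and l together lie in a hyperplane, then
   every such E has embedding dimension less than r. *)
Definition candidate (R : realType) (n r : nat) (P : 'M[option R]_n)
    (C : {set 'I_n}) (l : 'I_n) (beta : {set 'I_n})
    (E : 'M[R]_#|l |: C|) : Prop :=
  embeds r E /\ completes (principal (absorption_data P C l beta) (l |: C)) E.

(* The known data after all entries with both indices in C :|: {l} have been
   recorded with the values given by E. *)
Definition absorb (R : realType) (n : nat) (P : 'M[option R]_n)
    (C : {set 'I_n}) (l : 'I_n) (E : 'M[R]_#|l |: C|) : 'M[option R]_n :=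
  \matrix_(i, j)
    if (i \in l |: C) && (j \in l |: C)
    then Some (E (enum_rank_in (setU11 l C) i) (enum_rank_in (setU11 l C) j))
    else P i j.

(* Main.v *)
Require Import Defs.
From mathcomp Require Import all_boot all_order all_algebra.
From mathcomp Require Import reals zify ring lra.
Set Implicit Arguments. Unset Strict Implicit. Unset Printing Implicit Defensive.
Import Order.TTheory GRing.Theory Num.Theory.
Local Open Scope ring_scope.

(** Let [D] be the true distance matrix of the clique and l.  Realize it by
points of R^r and take a point [o] of [beta] as origin.  The rank condition
makes the points of [beta] span a subspace [H] of dimension at least r - 1,
because K^dagger of a distance matrix is J W J with [W] any based Gram matrix of
the same points ([rank_Kdagger]).  Split each point as a foot in [H] plus a
residual orthogonal to [H].  The coordinates of the foot solve a linear system
whose coefficients are inner products with points of [beta], hence are given by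
known distances. They are therefore the same for all realizations of all
completions, and only the inner products of residuals can differ
([residual_transfer]).

The residuals live in the orthogonal complement of [H], which is at most a line,
so their inner products have the form t_i t_j ([line_dot]).  The distances
inside the clique fix t_i t_j for i, j other than l, and the distance from l to
o fixes t_l^2.  Two such families can differ only by a sign in all the products
t_i t_l at once ([same_products]).  One sign gives [D], the other gives the
matrix [D'] obtained by reflecting the point of l in [H] ([two_completions]).
No isometry between two realizations is ever constructed: everything happens on
the level of inner products.

If [D'] could be realized in dimension s < r, the points of [beta] would already
span R^s, all residuals would vanish, and so would the residual of l in the
realization of [D]; the reflection would fix it, so that D' = D and [D] itself
would have embedding dimension below r.

Finally [D] is always feasible, so if only one of the two completions is
feasible it has to be the true one. *)

(** * The Euclidean inner product *)

Section Dot.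
Variables (R : realType) (s : nat).
Implicit Types u v w : 'rV[R]_s.

Definition dot u v : R := (u *m v^T) 0 0.

Lemma dotE u v : dot u v = \sum_k u 0 k * v 0 k.
Proof. by rewrite /dot mxE; apply: eq_bigr => k _; rewrite mxE. Qed.

Lemma dotC u v : dot u v = dot v u.
Proof. by rewrite !dotE; apply: eq_bigr => k _; rewrite mulrC. Qed.

Lemma dotDl u v w : dot (u + v) w = dot u w + dot v w.
Proof. by rewrite /dot mulmxDl mxE. Qed.

Lemma dotZl c u v : dot (c *: u) v = c * dot u v.
Proof. by rewrite /dot -scalemxAl mxE. Qed.

Lemma dotNl u v : dot (- u) v = - dot u v.
Proof. by rewrite /dot mulNmx mxE. Qed.

Lemma dotDr u v w : dot w (u + v) = dot w u + dot w v.
Proof. by rewrite dotC dotDl !(dotC w). Qed.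

Lemma dotZr c u v : dot u (c *: v) = c * dot u v.
Proof. by rewrite dotC dotZl dotC. Qed.

Lemma dotNr u v : dot u (- v) = - dot u v.
Proof. by rewrite dotC dotNl dotC. Qed.

Definition dot_lin := (dotDl, dotDr, dotNl, dotNr, dotZl, dotZr).

Lemma dot_ge0 u : 0 <= dot u u.
Proof. by rewrite dotE sumr_ge0 // => k _; rewrite -expr2 sqr_ge0. Qed.

Lemma dot_eq0 u : dot u u = 0 -> u = 0.
Proof.
rewrite dotE => u0; apply/rowP => k; rewrite mxE; apply/eqP.
rewrite -sqrf_eq0 expr2; apply/eqP.
by apply: (psumr_eq0P _ u0) => // i _; rewrite -expr2 sqr_ge0.
Qed.

Lemma sqdist_dot u v : sqdist u v = dot (u - v) (u - v).
Proof.
by rewrite dotE; apply: eq_bigr => k _; rewrite !mxE expr2.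
Qed.

Lemma sqdistC u v : sqdist u v = sqdist v u.
Proof. by rewrite !sqdist_dot -opprB dotNl dotNr opprK. Qed.

Lemma sqdist_refl u : sqdist u u = 0.
Proof. by rewrite sqdist_dot subrr /dot mul0mx mxE. Qed.

Lemma polarization o u v :
  dot (u - o) (v - o) = 2^-1 * (sqdist u o + sqdist v o - sqdist u v).
Proof.
by rewrite !sqdist_dot !dot_lin (dotC v u) (dotC o u) (dotC o v); field.
Qed.

Lemma dot_span m (M : 'M[R]_(m, s)) a u : u *m M^T = 0 -> dot (a *m M) u = 0.
Proof. by move=> uM; rewrite dotC /dot trmx_mul mulmxA uM mul0mx mxE. Qed.

End Dot.

(** * Linear algebra over the reals *)

(** Positivity of the inner product gives [M] and [M *m M^T] the same left
kernel, hence the same rank. *)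
Lemma sub_gram (R : realType) m s (M : 'M[R]_(m, s)) : (M^T <= M *m M^T)%MS.
Proof.
have sub : (kermx (M *m M^T) <= kermx M)%MS.
  apply/rV_subP => v /sub_kermxP vW; apply/sub_kermxP.
  by apply: dot_eq0; rewrite /dot trmx_mul mulmxA -(mulmxA v) vW mul0mx mxE.
have le : (\rank M^T <= \rank (M *m M^T))%N.
  move: (mxrankS sub); rewrite !mxrank_ker mxrank_tr.
  by have := rank_leq_row M; have := rank_leq_row (M *m M^T); lia.
have [_ <-] := mxrank_leqif_sup (submxMl M M^T).
by rewrite eqn_leq le mxrankS ?submxMl.
Qed.

(** Vectors orthogonal to a space of codimension at most one are multiples of a
single vector [nu].  Scaling the coefficients by the length of [nu] turns inner
products into products of reals, and covers the degenerate case nu = 0. *)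
Lemma line_dot (R : realType) m s (I : Type) (M : 'M[R]_(m, s))
    (u : I -> 'rV[R]_s) :
  (s <= (\rank M).+1)%N -> (forall i, u i *m M^T = 0) ->
  exists t : I -> R, forall i j, dot (u i) (u j) = t i * t j.
Proof.
move=> rkM uM; pose K := kermx M^T; pose nu := nz_row K.
have Knu : (K <= nu)%MS.
  have [->|nzK] := eqVneq K 0; first exact: sub0mx.
  have [_ <-] := mxrank_leqif_sup (nz_row_sub K).
  rewrite eqn_leq mxrankS ?nz_row_sub //= rank_rV nz_row_eq0 nzK.
  by rewrite mxrank_ker mxrank_tr; lia.
pose c i := (u i *m pinvmx nu) 0 0.
have uE i : u i = c i *: nu.
  have /mulmxKpV {1}<- : (u i <= nu)%MS.
    by apply: submx_trans Knu; apply/sub_kermxP.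
  by rewrite [_ *m pinvmx _]mx11_scalar mul_scalar_mx.
exists (fun i => c i * Num.sqrt (dot nu nu)) => i j.
by rewrite mulrACA -expr2 sqr_sqrtr ?dot_ge0 // !uE !dot_lin mulrA.
Qed.

(** Away from [l] the products determine [t] up to one global sign [d], unless
[t] vanishes there; at [l] the square determines it up to another sign [e].
Hence the products with [t l] are determined up to the common sign d e. *)
Lemma same_products (R : realType) (I : finType) (l : I) (s t : I -> R) :
  (forall i j, i != l -> j != l -> s i * s j = t i * t j) ->
  s l * s l = t l * t l ->
  (forall i, i != l -> s i * s l = t i * t l) \/
  (forall i, i != l -> s i * s l = - (t i * t l)).
Proof.
have sq_sign x y : x * x = y * y :> R ->
    exists2 e : R, x = e * y & e = 1 \/ e = -1.
  move/eqP; rewrite -!expr2 eqf_sqr => /orP[] /eqP->.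
    by exists 1; [rewrite mul1r | left].
  by exists (-1); [rewrite mulN1r | right].
move=> st /sq_sign[e -> e1].
have [d sE d1] : exists2 d : R,
    forall i, i != l -> s i = d * t i & d = 1 \/ d = -1.
  (* a nonzero entry, if there is one, decides the global sign *)
  case: (pickP [pred i | (i != l) && (t i != 0)]) => [k /andP[/= kl tk]|t0].
    have [d dE d1] := sq_sign _ _ (st k k kl kl).
    exists d => // i il; apply: (mulIf tk).
    by have := st i k il kl; rewrite dE; case: d1 => ->; lra.
  exists 1; last by left.
  move=> i il; move/negbT: (t0 i); rewrite /= il negbK => /eqP ti.
  apply/eqP; rewrite ti mulr0 -sqrf_eq0 expr2 st // ti mulr0 //.
by case: e1 => ->; case: d1 sE => -> sE; [left|right|right|left] => i il;
  rewrite sE //; ring.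
Qed.

(** * Feet and residuals *)

Section Residual.
Variables (R : realType) (m : nat) (I : Type).
Variables (b : 'I_m -> I) (a : I -> 'rV[R]_m).

Definition span_of s (x : I -> 'rV[R]_s) : 'M[R]_(m, s) := \matrix_k x (b k).

(** The coefficients [a] of the feet are a parameter independent of [x], so that
the same [a] can serve realizations in spaces of different dimensions. *)
Definition residual s (x : I -> 'rV[R]_s) i := x i - a i *m span_of x.

Lemma span_of_dot s (x : I -> 'rV[R]_s) w :
  w *m (span_of x)^T = \row_k dot w (x (b k)).
Proof.
apply/rowP => k; rewrite !mxE dotE; apply: eq_bigr => h _.
by rewrite !mxE.
Qed.

Lemma gramE s (x : I -> 'rV[R]_s) :
  span_of x *m (span_of x)^T = \matrix_(h, k) dot (x (b h)) (x (b k)).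
Proof.
apply/row_matrixP => h; rewrite row_mul rowK span_of_dot.
by apply/rowP => k; rewrite !mxE.
Qed.

(** The feet and the residuals being orthogonal, the inner product of the
residuals is what remains after subtracting that of the feet, and the latter
depends on [x] only through the Gram matrix of the spanning points. *)
Lemma residual_dot s (x : I -> 'rV[R]_s) :
  (forall i, residual x i *m (span_of x)^T = 0) ->
  forall i j, dot (residual x i) (residual x j) =
    dot (x i) (x j) - (a i *m (span_of x *m (span_of x)^T) *m (a j)^T) 0 0.
Proof.
move=> xM i j; rewrite {2}/residual dotDr dotNr [dot _ (_ *m _)]dotC dot_span //.
rewrite subr0 {1}/residual dotDl dotNl; congr (_ - _).
rewrite dotC; have {1}-> : x j = residual x j + a j *m span_of x by rewrite subrK.
rewrite dotDl dotC dot_span // add0r dotC /dot.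
by rewrite trmx_mul !mulmxA.
Qed.

(** The conditions defining [a] only involve inner products with the spanning
points.  A second realization [y] with the same such products thus satisfies
them for the same [a], and any change in an inner product is a change in the
inner product of the residuals. *)
Lemma residual_transfer s s' (x : I -> 'rV[R]_s) (y : I -> 'rV[R]_s') :
  (forall i k, dot (y i) (y (b k)) = dot (x i) (x (b k))) ->
  (forall i, residual x i *m (span_of x)^T = 0) ->
  (forall i, residual y i *m (span_of y)^T = 0) /\
  forall i j, dot (residual y i) (residual y j) =
    dot (residual x i) (residual x j) + (dot (y i) (y j) - dot (x i) (x j)).
Proof.
move=> yx xM.
have gyx : span_of y *m (span_of y)^T = span_of x *m (span_of x)^T.
  by rewrite !gramE; apply/matrixP => h k; rewrite !mxE yx.
have yM i : residual y i *m (span_of y)^T = 0.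
  rewrite -[RHS](xM i) !mulmxBl -!mulmxA gyx !span_of_dot; congr (_ - _).
  by apply/rowP => k; rewrite !mxE yx.
split=> // i j; rewrite (residual_dot yM) (residual_dot xM) gyx; ring.
Qed.

End Residual.

Lemma residual_ex (R : realType) m s (I : Type) (b : 'I_m -> I)
    (x : I -> 'rV[R]_s) :
  exists a, forall i, residual b a x i *m (span_of b x)^T = 0.
Proof.
pose M := span_of b x; exists (fun i => x i *m M^T *m pinvmx (M *m M^T)) => i.
rewrite /residual mulmxBl -(mulmxA _ M) mulmxKpV ?subrr //.
exact: submx_trans (submxMl _ _) (sub_gram M).
Qed.

(** * The rank condition *)

(** With squared lengths g_h = |q_h - o|^2, off the diagonal and on it,
D = g e^T + e g^T - 2 W.  As J e = 0, this gives K^dagger(D) = J W J, whatever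
the origin [o]. *)
Lemma rank_Kdagger (R : realType) m s (q : 'I_m -> 'rV[R]_s) o (D : 'M[R]_m) :
  (forall h k, D h k = sqdist (q h) (q k)) ->
  (\rank (Kdagger D) <= \rank (\matrix_(h, k) dot (q h - o) (q k - o)))%N.
Proof.
move=> DE; set W := (X in (_ <= \rank X)%N); pose J := centering R m.
case: m q D DE @W @J => [|m] q D DE W J; first by rewrite [Kdagger D]flatmx0 mxrank0.
pose e : 'cV[R]_m.+1 := const_mx 1; pose g : 'cV[R]_m.+1 := \col_h sqdist (q h) o.
have ee : const_mx 1 = e *m e^T :> 'M[R]_m.+1.
  by apply/matrixP => h k; rewrite !mxE big_ord1 !mxE mulr1.
have eJ : e^T *m J = 0.
  rewrite /J /centering mulmxBr mulmx1 -scalemxAr ee mulmxA.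
  have -> : e^T *m e = m.+1%:R%:M.
    rewrite [LHS]mx11_scalar !mxE; under eq_bigr do rewrite !mxE mulr1.
    by rewrite sumr_const card_ord.
  by rewrite mul_scalar_mx scalerA mulVf ?pnatr_eq0 // scale1r subrr.
have Je : J *m e = 0.
  apply: trmx_inj; rewrite trmx_mul trmx0 -eJ; congr (_ *m _).
  by rewrite /J /centering linearB linearZ /= trmx1 trmx_const.
have -> : Kdagger D = J *m W *m J.
  have offE : offDiag D = g *m e^T + e *m g^T - 2 *: W.
    apply/matrixP => h k; rewrite !mxE !big_ord1 !mxE polarization.
    by case: eqP => [->|_]; rewrite ?DE ?sqdist_refl; field.
  rewrite /Kdagger offE -/J; clearbody J; rewrite mulmxBr mulmxDr !mulmxA Je mul0mx addr0.
  rewrite mulmxBl -!mulmxA eJ !mulmx0 add0r -scalemxAl -scalemxAr.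
  by rewrite scaleNr scalerN opprK scalerA mulVf ?pnatr_eq0 // scale1r.
exact: leq_trans (mxrankM_maxl _ _) (mxrankM_maxr _ _).
Qed.

(** * The true completion and its mirror image *)

(** The indices [b k] stand for [beta] and [k0] is the index of the origin.  The
matrix [D'] can be written down without coordinates of the mirror image: moving
p_l to p_l - 2 u_l, where [u] denotes residuals, adds 4 u_i . u_l to the squared
distances from l and changes nothing else. *)
Theorem two_completions (R : realType) (N m r : nat) (D : 'M[R]_N) (l : 'I_N)
    (b : 'I_m -> 'I_N) (k0 : 'I_m) :
  embeds r D -> (forall k, b k != l) ->
  (\rank (Kdagger (mxsub b b D))).+1 = r ->
  exists D' : 'M[R]_N,
    (forall E, embeds r E /\
        [/\ forall i j, i != l -> j != l -> E i j = D i j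
          & forall k, E l (b k) = D l (b k)] <-> E = D \/ E = D') /\
    (embedding_dim D r -> embedding_dim D' r).
Proof.
move=> [p pD] bl rkD.
pose based s (q : 'I_N -> 'rV[R]_s) i := q i - q (b k0).
pose x := based r p.
have [a xM] := residual_ex b x; pose u := residual b a x.
have rkW : (r <= (\rank (span_of b x *m (span_of b x)^T)).+1)%N.
  rewrite -[leqLHS]rkD ltnS gramE.
  apply: (rank_Kdagger (q := fun k => p (b k)) (p (b k0))) => h k.
  by rewrite mxE.
pose D' : 'M[R]_N := \matrix_(i, j)
  (D i j + 4 * dot (u i) (u j) *+ ((i == l) (+) (j == l))).
(* the spanning points lie in the subspace, so mirroring keeps D l (b k) *)
have ub k i : dot (u (b k)) (u i) = 0.
  suff bu : dot (x (b k)) (u i) = 0.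
    by rewrite {1}/u /residual dotDl dotNl bu dot_span ?subrr // xM.
  by have /rowP/(_ k) := xM i; rewrite span_of_dot !mxE dotC.
(* What the prescribed entries say about the residuals of a realization of a
   completion, in any dimension; used with s = r to classify completions and
   with s < r to exclude smaller embedding dimensions. *)
have realize s (q : 'I_N -> 'rV[R]_s) (E : 'M[R]_N) :
    (forall i j, E i j = sqdist (q i) (q j)) ->
    (forall i j, i != l -> j != l -> E i j = D i j) ->
    (forall k, E l (b k) = D l (b k)) ->
    let v := residual b a (based s q) in
    [/\ forall i, v i *m (span_of b (based s q))^T = 0,
        (r <= (\rank (span_of b (based s q))).+1)%N,
        forall i j, i != l -> j != l -> dot (v i) (v j) = dot (u i) (u j),
        dot (v l) (v l) = dot (u l) (u l)
      & forall i, i != l ->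
          E i l = D i l + 2 * (dot (u i) (u l) - dot (v i) (v l))].
  move=> qE EC El v.
  have Eb i k : E i (b k) = D i (b k).
    by have [->|il] := eqVneq i l; [exact: El | exact: EC].
  have yx i j : dot (based s q i) (based s q j) - dot (x i) (x j) =
      2^-1 * (D i j - E i j).
    by rewrite !polarization -!pD -!qE !Eb; ring.
  have yxb i k : dot (based s q i) (based s q (b k)) = dot (x i) (x (b k)).
    by apply/eqP; rewrite -subr_eq0 yx Eb subrr mulr0.
  have [vM vu] := residual_transfer yxb xM.
  split=> //.
  - apply: leq_trans rkW _; rewrite ltnS.
    apply: leq_trans (mxrankM_maxl _ (span_of b (based s q))^T).
    rewrite !gramE; apply: eq_leq; congr (\rank _).
    by apply/matrixP => h k; rewrite !mxE yxb.
  - by move=> i j il jl; rewrite vu yx EC // subrr mulr0 addr0.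
  - by rewrite vu yx qE pD !sqdist_refl subrr mulr0 addr0.
  - by move=> i il; rewrite vu yx -/u; field.
have D'C i j : i != l -> j != l -> D' i j = D i j.
  by move=> il jl; rewrite mxE (negPf il) (negPf jl) mulr0n addr0.
have D'b k : D' l (b k) = D l (b k).
  by rewrite mxE eqxx (negPf (bl k)) dotC ub mulr0 mul0rn addr0.
have D'emb : embeds r D'.
  pose q i := if i == l then p l - 2 *: u l else p i.
  have qil i : sqdist (p i) (p l - 2 *: u l) = D i l + 4 * dot (u i) (u l).
    rewrite pD !sqdist_dot.
    have xu h : dot (x h) (u l) = dot (u h) (u l).
      by rewrite -[x h](subrK (a h *m span_of b x)) dotDl dot_span ?addr0 // xM.
    have -> : p i - (p l - 2 *: u l) = (p i - p l) + 2 *: u l.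
      by rewrite opprB addrA addrAC.
    have pip : p i - p l = x i - x l by rewrite /x /based opprB addrA subrK.
    have sq_shift (v w : 'rV[R]_r) :
        dot (v + 2 *: w) (v + 2 *: w) = dot v v + 4 * (dot v w + dot w w).
      by rewrite !dot_lin (dotC w v); ring.
    by rewrite sq_shift pip [dot (_ - _) (u l)]dotDl dotNl !xu subrK.
  exists q => i j; rewrite /q mxE.
  have [->|il] := eqVneq i l; have [->|jl] := eqVneq j l.
  - by rewrite mulr0n addr0 pD !sqdist_refl.
  - by rewrite mulr1n sqdistC qil dotC [D l j]pD sqdistC -pD.
  - by rewrite mulr1n qil.
  - by rewrite mulr0n addr0.
exists D'; split=> [E|Ddim]; last first.
  split=> // s [q qD']; rewrite leqNgt; apply/negP => lt_sr.
  have [vM rkv _ vl _] := realize _ _ _ qD' D'C D'b.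
  (* rank at least r - 1 >= s leaves no room for nonzero residuals *)
  have free : row_free (span_of b (based s q))^T.
    rewrite /row_free mxrank_tr eqn_leq rank_leq_col /=.
    by rewrite -ltnS (leq_trans lt_sr).
  have ul : u l = 0.
    apply: dot_eq0; rewrite -vl.
    suff -> : residual b a (based s q) l = 0 by rewrite /dot mul0mx mxE.
    by apply: (row_free_inj free); rewrite vM mul0mx.
  have D'D : D' = D.
    apply/matrixP => i j; rewrite mxE.
    have [->|il] := eqVneq i l.
      by rewrite ul /dot mul0mx mxE mulr0 mul0rn addr0.
    have [->|jl] := eqVneq j l.
      by rewrite ul /dot trmx0 mulmx0 mxE mulr0 mul0rn addr0.
    by rewrite mulr0n addr0.
  by have := Ddim.2 s; rewrite leqNgt lt_sr -D'D => /(_ (ex_intro _ q qD')).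
split=> [[[q qE] [EC El]]|[]->]; [|by split=> //; exists p|by []].
have [vM rkv vu vl Eil] := realize _ _ _ qE EC El.
have rkx : (r <= (\rank (span_of b x)).+1)%N.
  by apply: leq_trans rkW _; rewrite ltnS mxrankM_maxl.
have [t tE] := line_dot rkx xM; have [t' t'E] := line_dot rkv vM.
have Esym i k : E i k = E k i by rewrite !qE sqdistC.
have Dsym i k : D i k = D k i by rewrite !pD sqdistC.
have D'sym i k : D' i k = D' k i by rewrite !mxE Dsym dotC addbC.
have eq_row (F : 'M[R]_N) : (forall i k, F i k = F k i) -> F l l = 0 ->
    (forall i k, i != l -> k != l -> F i k = D i k) ->
    (forall i, i != l -> E i l = F i l) -> E = F.
  move=> Fsym Fll FC Fl; apply/matrixP => i k.
  have [->|il] := eqVneq i l; have [->|kl] := eqVneq k l.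
  - by rewrite Fll qE sqdist_refl.
  - by rewrite Esym Fsym Fl.
  - exact: Fl.
  - by rewrite EC // FC.
have Dll : D l l = 0 by rewrite pD sqdist_refl.
have [||same|opp] := @same_products R _ l t' t.
- by move=> i k il kl; rewrite -tE -t'E vu.
- by rewrite -tE -t'E vl.
- left; apply: eq_row => // i il.
  by rewrite Eil // tE t'E same // subrr mulr0 addr0.
- right; apply: eq_row => // [|i il].
    by rewrite mxE eqxx mulr0n addr0.
  rewrite Eil // mxE (negPf il) eqxx mulr1n /u tE t'E opp //; ring.
Qed.

(** * Absorbing a node into a clique *)

Theorem corollary2p18 (R : realType) (n r : nat) (D : 'M[R]_n)
    (P : 'M[option R]_n) (range : option R)
    (Ck : {set 'I_n}) (l : 'I_n) (j : 'I_r -> 'I_n) (beta : {set 'I_n})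
    (D_edm : EDM D)
    (D_dim : embedding_dim D r)
    (P_sym : P^T = P)
    (P_D : completes P D)
    (range_gt0 : forall rho, range = Some rho -> 0 < rho)
    (range_D : lower_bounds range P D)
    (Ck_clique : clique P Ck)
    (l_notin : l \notin Ck)
    (beta_def : beta = [set j i | i : 'I_r])
    (beta_sub : beta \subset Ck)
    (l_known : forall i, isSome (P l (j i)))
    (* rank = r - 1, without truncated subtraction *)
    (rank_beta : (\rank (Kdagger (principal D beta))).+1 = r) :
  exists E1 E2 : 'M[R]_#|l |: Ck|,
    [/\ forall E, candidate r P beta E <-> E = E1 \/ E = E2,
        embedding_dim (principal D (l |: Ck)) r ->
          embedding_dim E1 r /\ embedding_dim E2 r
      & forall E,
          unique (fun F => (F = E1 \/ F = E2)
                    /\ feasible range (principal P (l |: Ck)) F) E ->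
          [/\ clique (absorb P E) (l |: Ck),
              completes (absorb P E) D
            & forall i, i \in l |: Ck ->
                absorb P E l i = Some (D l i) /\ absorb P E i l = Some (D i l)]].
Proof.
pose A := l |: Ck; pose rho := enum_rank_in (setU11 l Ck).
have rhoK i : i \in A -> enum_val (rho i) = i by apply: enum_rankK_in.
have subA i : i \in Ck -> i \in A by apply: setU1r.
have lA : l \in A by apply: setU11.
have beta_A i : i \in beta -> i \in A by move/(subsetP beta_sub)/subA.
pose b (k : 'I_#|beta|) := rho (enum_val k).
have bK k : enum_val (b k) = enum_val k by rewrite rhoK // beta_A // enum_valP.
have at_l (i : 'I_#|A|) : enum_val i = l -> i = rho l.
  by move/(congr1 rho) => <-; rewrite /rho enum_valK_in.
have neq_l (i : 'I_#|A|) : enum_val i \in Ck -> i != rho l.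
  by apply: contraTneq => ->; rewrite rhoK.
have Aneq_l (i : 'I_#|A|) : i != rho l -> enum_val i \in Ck.
  by have /setU1P[/at_l->|//] := enum_valP i; rewrite eqxx.
have knownD i k : isSome (P i k) -> P i k = Some (D i k).
  by case PE: (P i k) => [v|] // _; rewrite (P_D _ _ _ PE).
have known_l i : i \in beta -> P l i = Some (D l i).
  by rewrite beta_def => /imsetP[h _ ->]; apply: knownD.
have r_gt0 : (0 < r)%N by rewrite -rank_beta.
have o_beta : j (Ordinal r_gt0) \in beta by rewrite beta_def imset_f.
have [[p pD] _] := D_dim.
have D_A : embeds r (principal D A).
  by exists (fun i => p (enum_val i)) => i k; rewrite mxE.
have rkb : (\rank (Kdagger (mxsub b b (principal D A)))).+1 = r.
  rewrite -[RHS]rank_beta; congr (\rank (Kdagger _)).+1.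
  by apply/matrixP => h k; rewrite !mxE !bK.
have bl k : b k != rho l by rewrite neq_l // bK (subsetP beta_sub) // enum_valP.
have [E2 [E2P E2dim]] :=
  two_completions (enum_rank_in o_beta (j (Ordinal r_gt0))) D_A bl rkb.
exists (principal D A), E2.
split; [move=> E | by move=> dimA; split=> //; exact: E2dim |].
  rewrite -E2P; split=> -[[q qE]].
    move=> EP; split; first by exists q.
    split=> [i k /Aneq_l iC /Aneq_l kC|k].
      rewrite [RHS]mxE; apply: EP; rewrite !mxE iC kC /=; apply: knownD.
      exact: Ck_clique.
    rewrite [RHS]mxE; apply: EP; rewrite !mxE !bK rhoK // eqxx enum_valP orbT.
    by rewrite known_l ?enum_valP.
  case=> EC Eb; split; first by exists q.
  have Eb' i : enum_val i \in beta -> E (rho l) i = D l (enum_val i).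
    move=> ib; have := Eb (enum_rank_in ib (enum_val i)).
    by rewrite /b enum_rankK_in // /rho enum_valK_in -/rho mxE rhoK.
  move=> i k v; rewrite !mxE; case: ifP => // + PE.
  rewrite -(P_D _ _ _ PE) => /or3P[/andP[iC kC]|/andP[/eqP il kb]|/andP[ib /eqP kl]].
  - by rewrite EC ?neq_l // mxE.
  - by rewrite (at_l i il) rhoK // -Eb'.
  - by rewrite (at_l k kl) rhoK // pD sqdistC -pD -Eb' // !qE sqdistC.
move=> E [[_ _] uniqE].
(* the true distances are feasible, so the unique feasible completion is true *)
have ED : E = principal D A.
  apply: uniqE; split; first by left.
  split=> [i k v|rho0 rr i k ik]; rewrite !mxE; first exact: P_D.
  by apply: range_D => //; apply: contra_neq ik => /enum_val_inj.
have absorbE i k : i \in A -> k \in A -> absorb P E i k = Some (D i k).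
  by move=> iA kA; rewrite mxE iA kA /= -/rho ED mxE !rhoK.
split=> [i k iA kA|i k v|i iA]; first by rewrite absorbE.
- rewrite mxE; case: ifP => [/andP[iA kA]|_]; last exact: P_D.
  by rewrite -/rho ED mxE !rhoK // => -[].
- by rewrite !absorbE.
Qed.
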